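(* Let $n\ge2$. There exist a finite set of primes $S$ and a super $S$-integral Descartes configuration in $\mathbb R^n$ if and only if $n=2k^2$ or $n=(2k-1)^2$ for some positive integer $k$.
   Context: For a finite set of primes $S$, a rational number is $S$-integral if its denominator (in lowest terms) is divisible only by primes in $S$. ''Sphere'' means an $(n-1)$-sphere in $\mathbb R^n$, hyperplanes being allowed as degenerate spheres (passing through $\infty$). An oriented sphere is a sphere with a chosen direction of unit normal; its signed curvature is $b=1/r$ for the inward normal and $b=-1/r$ for the outward normal ($r$ the radius), and its interior is the usual interior for the inward normal and the exterior for the outward normal. An oriented hyperplane has signed curvature $0$ and its interior is the open half-space into which its chosen unit normal points. A Descartes configuration in $\mathbb R^n$ consists of $n+2$ pairwise tangent spheres with all points of tangency distinct (parallel hyperplanes are tangent at $\infty$). It is oriented if its spheres are oriented so that either the interiors of all $n+2$ oriented spheres are pairwise disjoint, or they are pairwise disjoint after reversing all orientations. The augmented curvature-center coordinates of an oriented sphere with signed curvature $b\neq0$ and center $\mathbf x=(x_1,\dots,x_n)$ are $(\bar b,b,bx_1,\dots,bx_n)$ with $\bar b=b|\mathbf x|^2-1/b$; for an oriented hyperplane $\{\mathbf y:\mathbf y\cdot\mathbf h=m\}$ with unit normal $\mathbf h$ they are $(2m,0,h_1,\dots,h_n)$. For an ordered, oriented Descartes configuration $\mathcal D=(S_1,\dots,S_{n+2})$, $\mathbf W_{\mathcal D}$ is the $(n+2)\times(n+2)$ matrix whose $j$-th row is the coordinate vector of $S_j$. Known fact: $\mathcal D\mapsto\mathbf W_{\mathcal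 D}$ is a bijection from ordered, oriented Descartes configurations onto the real matrices $\mathbf W$ with $\mathbf W^T\mathbf Q_{D,n}\mathbf W=\mathbf Q_{W,n}$, where $\mathbf{Q}_{D,n}=\mathbf{I}_{n+2}-\frac1n\mathbf{1}\mathbf{1}^T$ with $\mathbf 1=(1,\dots,1)^T$, and $\mathbf{Q}_{W,n}=\begin{pmatrix}0&-4&0\\-4&0&0\\0&0&2\mathbf{I}_n\end{pmatrix}$. An (ordered, oriented) Descartes configuration $\mathcal D$ is super $S$-integral if all entries of $\mathbf W_{\mathcal D}$ are $S$-integral. *)

(* Defs.v *)
From mathcomp Require Import all_boot all_order all_algebra.
From mathcomp Require Import boolp classical_sets reals.

Set Implicit Arguments.
Unset Strict Implicit.
Unset Printing Implicit Defensive.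

Import Order.TTheory GRing.Theory Num.Theory.

Local Open Scope ring_scope.
Local Open Scope classical_set_scope.

Section Spheres.
Context {R : realType} {n : nat}.

Definition dotv (u v : 'rV[R]_n) : R := \sum_(i < n) u 0 i * v 0 i.

Definition sqnorm (u : 'rV[R]_n) : R := dotv u u.

(* [OSphere x r_gt0 inward] has center x and radius r, and is oriented by its
   inward unit normal iff [inward] is true.
   [OHyperplane m h1], with [h1 : sqnorm h = 1], is the hyperplane y.h = m oriented by h. *)
Inductive osphere : Type :=
| OSphere (x : 'rV[R]_n) (r : R) of 0 < r & bool
| OHyperplane (h : 'rV[R]_n) (m : R) of sqnorm h = 1.

Definition signed_curvature (S : osphere) : R :=
  match S with
  | OSphere x r _ inward => if inward then r^-1 else - r^-1
  | OHyperplane _ _ _ => 0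
  end.

(* Points of R^n extended by the point at infinity, which is [None]. *)
Definition carrier (S : osphere) : set (option 'rV[R]_n) :=
  match S with
  | OSphere x r _ _ =>
      [set p | if p is Some y then sqnorm (y - x) = r ^+ 2 else False]
  | OHyperplane h m _ =>
      [set p | if p is Some y then dotv y h = m else True]
  end.

Definition sphere_interior (S : osphere) : set 'rV[R]_n :=
  match S with
  | OSphere x r _ inward =>
      if inward then [set y | sqnorm (y - x) < r ^+ 2]
      else [set y | r ^+ 2 < sqnorm (y - x)]
  | OHyperplane h m _ => [set y | m < dotv y h]
  end.

Lemma sqnormN (h : 'rV[R]_n) : sqnorm h = 1 -> sqnorm (- h) = 1.
Proof. by move=> <-; apply: eq_bigr => i _; rewrite !mxE mulrNN. Qed.

Definition reverse (S : osphere) : osphere :=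
  match S with
  | OSphere x r r_gt0 inward => OSphere x r_gt0 (~~ inward)
  | OHyperplane h m h1 => OHyperplane (- m) (sqnormN h1)
  end.

(* For n >= 2, two spheres are tangent iff they meet in exactly one point of
   R^n extended by infinity; in particular parallel distinct hyperplanes are
   tangent at infinity. *)
Definition tangent_at (S T : osphere) (p : option 'rV[R]_n) : Prop :=
  carrier S `&` carrier T = [set p].

Definition descartes (D : 'I_n.+2 -> osphere) : Prop :=
  (forall i j, i != j -> exists p, tangent_at (D i) (D j) p) /\
  (forall (i j k l : 'I_n.+2) p, (i < j)%N -> (k < l)%N ->
     tangent_at (D i) (D j) p -> tangent_at (D k) (D l) p ->
     i = k /\ j = l).

Definition disjoint_interiors (D : 'I_n.+2 -> osphere) : Prop :=
  forall i j, i != j ->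
    sphere_interior (D i) `&` sphere_interior (D j) = set0.

Definition oriented_descartes (D : 'I_n.+2 -> osphere) : Prop :=
  descartes D /\
  (disjoint_interiors D \/ disjoint_interiors (fun i => reverse (D i))).

Definition curvature_center (S : osphere) : 'rV[R]_(1 + (1 + n)) :=
  match S with
  | OSphere x _ _ _ =>
      let b := signed_curvature S in
      row_mx (b * sqnorm x - b^-1)%:M (row_mx b%:M (b *: x))
  | OHyperplane h m _ => row_mx (2 * m)%:M (row_mx 0%:M h)
  end.

Definition curvature_center_mx (D : 'I_n.+2 -> osphere) :
    'M[R]_(n.+2, 1 + (1 + n)) :=
  \matrix_(i < n.+2) curvature_center (D i).

End Spheres.

Arguments osphere : clear implicits.

(* The finite set of primes is given as a sequence [S]. *)
Definition S_integral (R : realType) (S : seq nat) (x : R) : Prop :=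
  exists2 q : rat, x = ratr q &
    forall p : nat, prime p -> (p %| `|denq q|)%N -> p \in S.

Definition super_S_integral (R : realType) (n : nat) (S : seq nat)
    (D : 'I_n.+2 -> osphere R n) : Prop :=
  oriented_descartes D /\
  forall i j, S_integral S (curvature_center_mx D i j).

(* Main.v *)
(* In curvature-center coordinates, tangent spheres with disjoint interiors have
   Lorentz product -1, and every sphere has Lorentz square 1; so a Descartes
   configuration has Gram matrix [2I - J], of determinant [- n 2^(n+1)], and if
   its coordinates are rational then [n 2^(n+1)] is the square of a rational:
   for even [n] this makes [2n] a square, for odd [n] it makes [n] a square.
   Conversely, two parallel hyperplanes together with [n] unit spheres between
   them, centered at a regular simplex of edge 2, form a Descartes
   configuration, so it suffices to find a rational such simplex in a hyperplane
   with rational unit normal.  For [n = 2k^2] the rows of a rational [B] with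
   [B B^T = 2I] will do, the sum of the rows having rational length [2k].  For
   [n = m^2] odd, a rational isometry sends [(1, ..., 1)] to [m e_n]; it
   carries the standard basis to a regular simplex of squared edge 2 in a
   coordinate hyperplane of even dimension [n - 1], where a rational similarity
   doubles squared lengths. *)
Require Import Defs.
From mathcomp Require Import all_boot all_order all_algebra.
From mathcomp Require Import boolp classical_sets reals.
From mathcomp Require Import ring lra zify.

Set Implicit Arguments.
Unset Strict Implicit.
Unset Printing Implicit Defensive.

Import Order.TTheory GRing.Theory Num.Theory.

Local Open Scope ring_scope.
Local Open Scope classical_set_scope.

(** * Euclidean dot product *)

Section DotProduct.
Context {R : realType} {n : nat}.
Implicit Types (u v w : 'rV[R]_n) (a : R).

Lemma dotvC u v : dotv u v = dotv v u.
Proof. by apply: eq_bigr => i _; rewrite mulrC. Qed.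

Lemma dotvDl u v w : dotv (u + v) w = dotv u w + dotv v w.
Proof.
by rewrite /dotv -big_split; apply: eq_bigr => i _; rewrite mxE mulrDl.
Qed.

Lemma dotvZl a u w : dotv (a *: u) w = a * dotv u w.
Proof.
by rewrite /dotv mulr_sumr; apply: eq_bigr => i _; rewrite mxE mulrA.
Qed.

Lemma dotvNl u w : dotv (- u) w = - dotv u w.
Proof. by rewrite -scaleN1r dotvZl mulN1r. Qed.

Lemma dotvDr u v w : dotv w (u + v) = dotv w u + dotv w v.
Proof. by rewrite !(dotvC w) dotvDl. Qed.

Lemma dotvZr a u w : dotv w (a *: u) = a * dotv w u.
Proof. by rewrite !(dotvC w) dotvZl. Qed.

Lemma dotvNr u w : dotv w (- u) = - dotv w u.
Proof. by rewrite !(dotvC w) dotvNl. Qed.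

Definition dotvE := (dotvDl, dotvDr, dotvNl, dotvNr, dotvZl, dotvZr).

Lemma sqnorm_ge0 u : 0 <= sqnorm u.
Proof. by apply: sumr_ge0 => i _; rewrite -expr2 sqr_ge0. Qed.

Lemma sqnorm_eq0 u : (sqnorm u == 0) = (u == 0).
Proof.
apply/eqP/eqP => [u0|->]; last by apply: big1 => i _; rewrite mxE mul0r.
apply/rowP => i; rewrite mxE; apply/eqP; rewrite -sqrf_eq0 expr2.
apply/eqP; move: i (erefl true).
by apply: psumr_eq0P u0 => i _; rewrite -expr2 sqr_ge0.
Qed.

Lemma sqnormD u v : sqnorm (u + v) = sqnorm u + 2 * dotv u v + sqnorm v.
Proof. by rewrite /sqnorm !dotvE (dotvC v u); ring. Qed.

Lemma dotv_unit_ge u v : sqnorm u = 1 -> sqnorm v = 1 -> -1 <= dotv u v.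
Proof. by have := sqnorm_ge0 (u + v); rewrite sqnormD => ? u1 v1; lra. Qed.

(** The squared norm of the sum would be [3 - 6 < 0]. *)
Lemma no_three_opposite_units u v w :
  sqnorm u = 1 -> sqnorm v = 1 -> sqnorm w = 1 ->
  dotv u v = -1 -> dotv u w = -1 -> dotv v w = -1 -> False.
Proof.
move=> u1 v1 w1 uv uw vw; have := sqnorm_ge0 (u + v + w).
by rewrite sqnormD sqnormD dotvDl; lra.
Qed.

End DotProduct.

(** * Lorentz product of oriented spheres, tangency and interiors *)

Section Lorentz.
Context {R : realType} {n : nat}.
Implicit Types (S T : osphere R n) (y : 'rV[R]_n).

(** The coordinate $\bar b$: the signed curvature of the image under inversion in the unit
    sphere. *)
Definition cobend S : R :=
  match S with
  | OSphere x _ _ _ =>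
      signed_curvature S * sqnorm x - (signed_curvature S)^-1
  | OHyperplane _ m _ => 2 * m
  end.

Definition bend_center S : 'rV[R]_n :=
  match S with
  | OSphere x _ _ _ => signed_curvature S *: x
  | OHyperplane h _ _ => h
  end.

Lemma curvature_centerE S :
  curvature_center S =
  row_mx (cobend S)%:M (row_mx (signed_curvature S)%:M (bend_center S)).
Proof. by case: S. Qed.

(** In curvature-center coordinates, the bilinear form with matrix $2\mathbf Q_{W,n}^{-1}$. *)
Definition lorentz S T : R :=
  dotv (bend_center S) (bend_center T)
  - 2^-1 * (cobend S * signed_curvature T + signed_curvature S * cobend T).

(* The Lorentz product of [S] with the null vector of the point [y]: it vanishes
   exactly on the sphere and is positive exactly in its interior. *)
Definition power S y : R :=
  dotv (bend_center S) y - 2^-1 * (signed_curvature S * sqnorm y + cobend S).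

Lemma signed_curvature_neq0 x (r : R) (r0 : 0 < r) b :
  signed_curvature (OSphere x r0 b : osphere R n) != 0.
Proof. by case: b => /=; rewrite ?oppr_eq0 invr_neq0 // gt_eqF. Qed.

Lemma lorentz_self S : lorentz S S = 1.
Proof.
case: S => [x r r0 b|h m h1]; last first.
  by rewrite /lorentz /= -/(sqnorm h) h1; ring.
rewrite /lorentz /cobend /bend_center; move: (signed_curvature_neq0 x r0 b).
set c := signed_curvature _ => c0; rewrite !dotvE -/(sqnorm x).
by field.
Qed.

Lemma power_sphere x (r : R) (r0 : 0 < r) b y :
  power (OSphere x r0 b) y =
  (if b then 1 else -1) * (2 * r)^-1 * (r ^+ 2 - sqnorm (y - x)).
Proof.
rewrite /power /= sqnormD /sqnorm !dotvE (dotvC x y).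
have r_neq0 : r != 0 by rewrite gt_eqF.
by case: b; field.
Qed.

Lemma carrier_Some S y : carrier S (Some y) <-> power S y = 0.
Proof.
case: S => [x r r0 b|h m h1]; last first.
  rewrite /power /= (dotvC h y) mul0r add0r mulrA mulVf ?pnatr_eq0 // mul1r.
  by split=> [->|/eqP]; rewrite ?subrr // subr_eq0 => /eqP.
rewrite power_sphere /=; split=> [->|]; first by rewrite subrr mulr0.
move=> /eqP; rewrite !mulf_eq0 invr_eq0 mulf_eq0 pnatr_eq0 (gt_eqF r0) /=.
by case: b; rewrite ?oppr_eq0 oner_eq0 /= subr_eq0 => /eqP.
Qed.

Lemma carrier_None S : carrier S None <-> signed_curvature S = 0.
Proof.
case: S => [x r r0 b|h m h1] //.
by split=> // /eqP; rewrite (negbTE (signed_curvature_neq0 x r0 b)).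
Qed.

Lemma interiorE S y : sphere_interior S y <-> 0 < power S y.
Proof.
case: S => [x r r0 b|h m h1]; last first.
  by rewrite /power /= (dotvC h y) mul0r add0r mulrA mulVf ?pnatr_eq0 // mul1r
    subr_gt0.
have r2 : 0 < (2 * r)^-1 by rewrite invr_gt0 mulr_gt0.
rewrite power_sphere; case: b => /=.
  by rewrite mul1r pmulr_rgt0 // subr_gt0.
by rewrite mulN1r mulNr -mulrN opprB pmulr_rgt0 // subr_gt0.
Qed.

(* The unit normal at a point of the sphere, pointing into the interior. *)
Definition normal_at S y := bend_center S - signed_curvature S *: y.

Lemma power_shift S y z :
  power S (y + z) =
  power S y + dotv (normal_at S y) z - 2^-1 * signed_curvature S * sqnorm z.
Proof. by rewrite /power /normal_at sqnormD !dotvE; field. Qed.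

(** The vanishing powers determine both cobends; substituting them into the Lorentz product leaves
    the product of the normals. *)
Lemma dotv_normal_at S T y : power S y = 0 -> power T y = 0 ->
  dotv (normal_at S y) (normal_at T y) = lorentz S T.
Proof.
rewrite /power /normal_at /lorentz !dotvE (dotvC y) -/(sqnorm y) => S0 T0.
have -> : cobend S = 2 * dotv (bend_center S) y - signed_curvature S * sqnorm y.
  by lra.
have -> : cobend T = 2 * dotv (bend_center T) y - signed_curvature T * sqnorm y.
  by lra.
by field.
Qed.

Lemma sqnorm_normal_at S y : power S y = 0 -> sqnorm (normal_at S y) = 1.
Proof. by move=> S0; rewrite /sqnorm dotv_normal_at // lorentz_self. Qed.

Lemma lorentz_hyperplane S T :
  signed_curvature S = 0 -> signed_curvature T = 0 ->
  lorentz S T = dotv (bend_center S) (bend_center T).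
Proof. by rewrite /lorentz => -> ->; ring. Qed.

Lemma sqnorm_bend_center S :
  signed_curvature S = 0 -> sqnorm (bend_center S) = 1.
Proof. by move=> S0; rewrite /sqnorm -lorentz_hyperplane // lorentz_self. Qed.

(* If the inner unit normals were not opposite at a common point, moving from it
   along their sum would enter both interiors. *)
Lemma lorentz_tangent S T p :
  carrier S p -> carrier T p ->
  sphere_interior S `&` sphere_interior T = set0 -> lorentz S T = -1.
Proof.
move=> Sp Tp disj.
have out y : 0 < power S y -> 0 < power T y -> False.
  move=> Sy Ty; have : (sphere_interior S `&` sphere_interior T) y.
    by split; apply/interiorE.
  by rewrite disj.
case: p Sp Tp => [y /carrier_Some Sy /carrier_Some Ty|]; last first.
  move=> /carrier_None bS /carrier_None bT.
  rewrite lorentz_hyperplane //.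
  have vS := sqnorm_bend_center bS; have vT := sqnorm_bend_center bT.
  apply/eqP; rewrite eq_le dotv_unit_ge // andbT leNgt; apply/negP => gtN1.
  set u := bend_center S in vS gtN1; set v := bend_center T in vT gtN1.
  set d := 1 + dotv u v; have d0 : 0 < d by rewrite /d; lra.
  (* At infinity: the powers at [t *: (u + v)] are [t * d] minus half a cobend, so a large [t] makes
     both positive. *)
  pose t := (1 + `|cobend S| + `|cobend T|) / d.
  have td : t * d = 1 + `|cobend S| + `|cobend T| by rewrite divfK // gt_eqF.
  have := ler_norm (cobend S); have := ler_norm (cobend T).
  have := normr_ge0 (cobend S); have := normr_ge0 (cobend T) => *.
  apply: (out (t *: (u + v))); rewrite /power ?bS ?bT !dotvE -/u -/v.
    by rewrite -/(sqnorm u) vS; move: td; rewrite /d; lra.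
  by rewrite -/(sqnorm v) vT (dotvC v u); move: td; rewrite /d; lra.
rewrite -(dotv_normal_at Sy Ty).
have uS := sqnorm_normal_at Sy; have uT := sqnorm_normal_at Ty.
apply/eqP; rewrite eq_le dotv_unit_ge // andbT leNgt; apply/negP => gtN1.
set u := normal_at S y in uS gtN1; set v := normal_at T y in uT gtN1.
set d := 1 + dotv u v; have d0 : 0 < d by rewrite /d; lra.
pose c := 1 + `|signed_curvature S| + `|signed_curvature T|.
have := normr_ge0 (signed_curvature S); have := normr_ge0 (signed_curvature T).
move=> bT0 bS0.
have c0 : 0 < c by rewrite /c; lra.
(* The power after the move is [t * d * (1 - t * b)] with [b] the curvature; this [t] keeps [t * b]
   at most [1/2]. *)
pose t := (2 * c)^-1.
have t0 : 0 < t by rewrite invr_gt0 mulr_gt0.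
have tc : t * c = 2^-1 by rewrite /t; field; rewrite gt_eqF.
have nuv : sqnorm (t *: (u + v)) = 2 * t ^+ 2 * d.
  have -> : sqnorm (t *: (u + v)) = t ^+ 2 * sqnorm (u + v).
    by rewrite /sqnorm dotvZl dotvZr; ring.
  by rewrite sqnormD uS uT /d; ring.
have pos b : `|b| <= c -> 0 < t * d - 2^-1 * b * (2 * t ^+ 2 * d).
  move=> bc; have b1 : t * b <= 2^-1.
    rewrite -tc ler_pM2l //; exact: le_trans (ler_norm b) bc.
  have -> : t * d - 2^-1 * b * (2 * t ^+ 2 * d) = t * d * (1 - t * b) by field.
  by rewrite !mulr_gt0 //; lra.
apply: (out (y + t *: (u + v))); rewrite power_shift ?Sy ?Ty add0r nuv.
  have -> : dotv (normal_at S y) (t *: (u + v)) = t * d.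
    by rewrite -/u dotvZr dotvDr -/(sqnorm u) uS.
  by apply: pos; rewrite /c; lra.
have -> : dotv (normal_at T y) (t *: (u + v)) = t * d.
  by rewrite -/v dotvZr dotvDr -/(sqnorm v) uT (dotvC v u) addrC.
by apply: pos; rewrite /c; lra.
Qed.

(** Reversal negates all coordinates, and the form is bilinear. This covers configurations whose
    interiors are disjoint only after reversal. *)
Lemma lorentz_reverse S T : lorentz (reverse S) (reverse T) = lorentz S T.
Proof.
have bN (U : osphere R n) : signed_curvature (reverse U) = - signed_curvature U.
  by case: U => [x r r0 []|h m h1] /=; rewrite ?opprK ?oppr0.
have cN (U : osphere R n) : cobend (reverse U) = - cobend U.
  case: U => [x r r0 b|h m h1] /=; last by rewrite mulrN.
  by have := bN (OSphere x r0 b) => /= ->; rewrite invrN; ring.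
have vN (U : osphere R n) : bend_center (reverse U) = - bend_center U.
  case: U => [x r r0 b|h m h1] //=.
  by have := bN (OSphere x r0 b) => /= ->; rewrite scaleNr.
by rewrite /lorentz !bN !cN !vN !dotvE; ring.
Qed.

Lemma carrier_reverse S p : carrier (reverse S) p <-> carrier S p.
Proof.
case: S => [x r r0 b|h m h1] //=; case: p => [y|] //=.
by rewrite dotvNr; split=> [/oppr_inj|->].
Qed.

Lemma lorentz_descartes (D : 'I_n.+2 -> osphere R n) i j :
  oriented_descartes D -> i != j -> lorentz (D i) (D j) = -1.
Proof.
move=> [[tang _] disj] ij; have [p Tp] := tang _ _ ij.
have [Di Dj] : (carrier (D i) `&` carrier (D j)) p by rewrite Tp.
case: disj => disj; first exact: lorentz_tangent Di Dj (disj _ _ ij).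
rewrite -lorentz_reverse; apply: lorentz_tangent (disj _ _ ij).
  exact/carrier_reverse/Di.
exact/carrier_reverse/Dj.
Qed.

(* The sum of the two Lorentz vectors is isotropic, so it represents the point
   of tangency, and the sum of the two powers has constant sign. *)
Lemma lorentz_tangent_at S T :
  lorentz S T = -1 -> 0 < signed_curvature S + signed_curvature T ->
  (exists p, tangent_at S T p) /\ sphere_interior S `&` sphere_interior T = set0.
Proof.
move=> L b0; set b := _ + _ in b0.
have bN0 : b != 0 by rewrite gt_eqF.
have LS := lorentz_self S; have LT := lorentz_self T.
have [x bx] : exists x, bend_center S + bend_center T = b *: x.
  exists (b^-1 *: (bend_center S + bend_center T)).
  by rewrite scalerA divff // scale1r.
have sumcob : cobend S + cobend T = b * sqnorm x.
  apply: (mulfI bN0); have -> : b * (b * sqnorm x) = sqnorm (b *: x).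
    by rewrite /sqnorm !dotvE.
  rewrite -bx sqnormD; move: L LS LT; rewrite /lorentz /b /sqnorm => L LS LT.
  by lra.
have sum y : power S y + power T y = - (2^-1 * b * sqnorm (y - x)).
  have -> : power S y + power T y = dotv (bend_center S + bend_center T) y
      - 2^-1 * (b * sqnorm y + (cobend S + cobend T)).
    by rewrite /power dotvDl /b; ring.
  by rewrite bx sumcob /sqnorm !dotvE (dotvC y x); field.
(* Up to the factor [b], this power is the Lorentz product of [S] with the sum of the two vectors,
   that is [1 - 1]. *)
have px : power S x = 0.
  apply: (mulfI bN0); rewrite mulr0.
  have -> : b * power S x = dotv (bend_center S) (b *: x)
     - 2^-1 * (signed_curvature S * (b * sqnorm x) + b * cobend S).
    by rewrite /power dotvZr; ring.
  rewrite -bx -sumcob dotvDr /b; move: L LS; rewrite /lorentz; lra.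
split; last first.
  rewrite -subset0 => y [/interiorE Sy /interiorE Ty].
  have := sum y; have : 0 <= 2^-1 * b * sqnorm (y - x).
    by rewrite !mulr_ge0 ?sqnorm_ge0 ?invr_ge0 // ltW.
  by lra.
exists (Some x); apply/seteqP; split => [[y|]|_ ->] /=.
- move=> [/carrier_Some Sy /carrier_Some Ty].
  have /esym/eqP := sum y; rewrite Sy Ty addr0 oppr_eq0 !mulf_eq0 invr_eq0.
  by rewrite pnatr_eq0 (negbTE bN0) /= sqnorm_eq0 subr_eq0 => /eqP ->.
- move=> [/carrier_None Sb /carrier_None Tb].
  by move: b0; rewrite /b Sb Tb addr0 ltxx.
split; apply/carrier_Some => //.
have /eqP := sum x; rewrite px add0r subrr => /eqP ->.
have -> : sqnorm (0 : 'rV[R]_n) = 0 by apply/eqP; rewrite sqnorm_eq0.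
by rewrite mulr0 oppr0.
Qed.

(** The normals are opposite unit vectors, so the sum of the two powers is a negative constant. *)
Lemma lorentz_parallel S T :
  lorentz S T = -1 -> signed_curvature S = 0 -> signed_curvature T = 0 ->
  0 < cobend S + cobend T ->
  (exists p, tangent_at S T p) /\ sphere_interior S `&` sphere_interior T = set0.
Proof.
move=> L bS bT c0.
have vS := sqnorm_bend_center bS; have vT := sqnorm_bend_center bT.
have v0 : bend_center S + bend_center T = 0.
  apply/eqP; rewrite -sqnorm_eq0 sqnormD vS vT -lorentz_hyperplane // L.
  by apply/eqP; ring.
have sum y : power S y + power T y < 0.
  have -> : power S y + power T y = dotv (bend_center S + bend_center T) y
      - 2^-1 * (cobend S + cobend T).
    by rewrite /power bS bT dotvDl; ring.
  have -> : dotv (bend_center S + bend_center T) y = 0.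
    by rewrite v0 /dotv big1 // => i _; rewrite mxE mul0r.
  by lra.
split; last first.
  rewrite -subset0 => y [/interiorE Sy /interiorE Ty].
  by have := sum y; lra.
exists None; apply/seteqP; split => [[y|]|_ ->] //=.
  move=> [/carrier_Some Sy /carrier_Some Ty].
  by have := sum y; rewrite Sy Ty addr0 ltxx.
by split; apply/carrier_None.
Qed.

(** The three unit normals at a common point, finite or infinite, would be pairwise opposite. *)
Lemma no_three_through S T U p :
  lorentz S T = -1 -> lorentz S U = -1 -> lorentz T U = -1 ->
  carrier S p -> carrier T p -> carrier U p -> False.
Proof.
case: p => [y|] ST SU TU.
  move=> /carrier_Some Sy /carrier_Some Ty /carrier_Some Uy.
  apply: (@no_three_opposite_units _ _ (normal_at S y) (normal_at T y)
    (normal_at U y)); by rewrite ?sqnorm_normal_at ?dotv_normal_at.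
move=> /carrier_None bS /carrier_None bT /carrier_None bU.
apply: (@no_three_opposite_units _ _ (bend_center S) (bend_center T)
  (bend_center U)); by rewrite ?sqnorm_bend_center // -lorentz_hyperplane.
Qed.

(** The product [-1] is invariant under reversal; the sign of the summed curvatures, or cobends for
    hyperplanes, selects the orientation with disjoint interiors. Tangency points are distinct
    because no third sphere passes through one. *)
Lemma oriented_descartes_lorentz (D : 'I_n.+2 -> osphere R n) :
  (forall i j, i != j -> lorentz (D i) (D j) = -1) ->
  (forall i j, i != j -> 0 < signed_curvature (D i) + signed_curvature (D j) \/
     [/\ signed_curvature (D i) = 0, signed_curvature (D j) = 0
       & 0 < cobend (D i) + cobend (D j)]) ->
  oriented_descartes D.
Proof.
move=> L pos.
have tang i j : i != j -> (exists p, tangent_at (D i) (D j) p) /\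
    sphere_interior (D i) `&` sphere_interior (D j) = set0.
  move=> ij; case: (pos _ _ ij) => [|[]]; first exact/lorentz_tangent_at/L.
  exact/lorentz_parallel/L.
split; last by left=> i j /tang[].
split=> [i j /tang[]//|i j k l p ij kl Tij Tkl].
have [Di Dj] : (carrier (D i) `&` carrier (D j)) p by rewrite Tij.
have [Dk Dl] : (carrier (D k) `&` carrier (D l)) p by rewrite Tkl.
have only q : carrier (D q) p -> q = i \/ q = j.
  move=> Dq; apply: contrapT => /not_orP[/eqP qi /eqP qj].
  have nij : i != j by rewrite neq_ltn ij.
  by apply: (no_three_through _ _ _ Dq Di Dj); rewrite L.
by case: (only k Dk) (only l Dl) kl ij => -> [] ->; rewrite ?ltnn // => /ltnW;
  rewrite leqNgt => /negPf ->.
Qed.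

End Lorentz.

(** * A determinant and the arithmetic of the dimension *)

(* Two triangular factorisations of a bordered matrix with Schur complements
   [c%:M - v *m u] and [c - u *m v]. *)
Lemma det_scalar_sub_const (F : fieldType) N (c : F) : c != 0 ->
  \det (c%:M - const_mx 1 : 'M_N.+1) = c ^+ N * (c - N.+1%:R).
Proof.
move=> c0; set n := N.+1.
pose u : 'M[F]_(1, n) := const_mx 1; pose v : 'M[F]_(n, 1) := const_mx 1.
have vu : v *m u = const_mx 1.
  by apply/matrixP => i j; rewrite !mxE big_ord1 !mxE mulr1.
have uv : u *m v = n%:R%:M.
  apply/matrixP => i j; rewrite !ord1 !mxE eqxx mulr1n.
  rewrite (eq_bigr (fun=> 1)) => [|k _]; last by rewrite !mxE mulr1.
  by rewrite sumr_const card_ord.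
pose M := block_mx 1%:M u v (c%:M : 'M_n).
have M1 : M = block_mx 1%:M 0 v 1%:M *m block_mx 1%:M u 0 (c%:M - v *m u).
  rewrite mulmx_block !mul1mx !mulmx1 !mul0mx !addr0.
  by rewrite addrC subrK.
have M2 : M = block_mx (1%:M - c^-1 *: (u *m v)) u 0 c%:M *m
    block_mx 1%:M 0 (c^-1 *: v) 1%:M.
  rewrite mulmx_block !mulmx1 !mul0mx !mulmx0 !add0r -scalemxAr subrK.
  by rewrite mul_scalar_mx scalerA mulfV // scale1r.
have := congr1 determinant M1; rewrite M2 !det_mulmx.
rewrite !det_lblock !det_ublock !det1 !mul1r !mulr1 det_scalar vu uv => <-.
rewrite det_mx11 !mxE /= /n exprS.
by field.
Qed.

(** The squared denominator divides the squared numerator and is coprime to it, hence is 1. *)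
Lemma rat_sqr_nat (q : rat) (a : nat) : q ^+ 2 = a%:R ->
  exists m : nat, a = (m ^ 2)%N.
Proof.
move=> qa; exists `|numq q|%N.
have E : (`|numq q| ^ 2 = a * `|denq q| ^ 2)%N.
  have : numq q ^+ 2 = a%:Z * denq q ^+ 2.
    apply: (@intr_inj rat); rewrite rmorphXn rmorphM rmorphXn /=.
    by rewrite -[a%:~R]qa -{2}(divq_num_den q) -exprMn divfK // intr_eq0 denq_neq0.
  by lia.
have : coprime (`|denq q| ^ 2) (`|numq q| ^ 2).
  by rewrite coprimeXl // coprimeXr // coprime_sym coprime_num_den.
by rewrite /coprime E gcdnMl => /eqP d1; rewrite d1 muln1.
Qed.

Lemma rational_square_cases n : (0 < n)%N -> (exists q : rat, q ^+ 2 = (n * 2 ^ n.+1)%:R) ->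
  exists k : nat, (0 < k)%N /\ (n = (2 * k ^ 2)%N \/ n = ((2 * k - 1) ^ 2)%N).
Proof.
move=> n0 [q /rat_sqr_nat [m nm]].
(* An even power of 2 cancels from a square: all of [2 ^ n.+1] for odd [n], all but one factor for
   even [n]. *)
have root j a : (a * (2 ^ j) ^ 2 = m ^ 2 -> exists l, a = l ^ 2)%N.
  move=> am; have /dvdnP [l ml] : (2 ^ j %| m)%N.
    by rewrite -(@dvdn_pexp2r _ _ 2) // -am dvdn_mull.
  exists l; apply/eqP; rewrite -(@eqn_pmul2r ((2 ^ j) ^ 2)) ?expn_gt0 //.
  by rewrite am ml expnMn.
case: (boolP (odd n)) => odd_n.
  have [l nl] : exists l, n = (l ^ 2)%N.
    apply: (root n.+1./2); rewrite -nm -expnM muln2; congr (_ * 2 ^ _)%N.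
    by lia.
  exists l.+1./2; have ol : odd l by move: odd_n; rewrite nl oddX.
  by split; [lia | right; rewrite nl; congr (_ ^ 2)%N; lia].
have [l nl] : exists l, (2 * n = l ^ 2)%N.
  apply: (root n./2); rewrite -nm -expnM muln2 expnS.
  have -> : (n./2.*2 = n)%N by lia.
  by ring.
have el : ~~ odd l.
  by apply/negP => ol; have := congr1 odd nl; rewrite oddX ol mul2n odd_double.
exists l./2; have l2 : l = (2 * l./2)%N by lia.
split; last by left; move: nl; rewrite {1}l2; nia.
by rewrite lt0n; apply/eqP => l0; move: nl; rewrite l2 l0; lia.
Qed.

(** * Rational regular simplices *)

Lemma orthogonal_double n : ~~ odd n -> exists B : 'M[rat]_n, B *m B^T = 2%:M.
Proof.
move=> /negPf on; have : n = (n./2 + n./2)%N by lia.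
move: (n./2) => j {on} ->.
exists (block_mx 1%:M 1%:M 1%:M (- 1%:M)).
rewrite tr_block_mx mulmx_block !linearN /= !trmx1 !(mulmxN, mulNmx, mulmx1).
rewrite opprK subrr -raddfD /=.
by rewrite [RHS]scalar_mx_block.
Qed.

(* [U] consists of the last [n] columns of an orthogonal matrix whose first column
   is constant, equal to [1 / m]. *)
Lemma simplex_columns n m : n.+1 = (m ^ 2)%N ->
  exists U : 'M[rat]_(n.+1, n),
    U *m U^T = 1%:M - n.+1%:R^-1 *: const_mx 1.
Proof.
move=> nm.
have m0 : m%:R != 0 :> rat by rewrite pnatr_eq0; case: m nm.
have m1 : m%:R + 1 != 0 :> rat by rewrite -(natrD _ m 1) pnatr_eq0 addn1.
have nE : n%:R = m%:R ^+ 2 - 1 :> rat.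
  by rewrite -natrX -nm -addn1 natrD addrK.
have n1E : n.+1%:R = m%:R ^+ 2 :> rat by rewrite nm natrX.
(* Entries of the Householder reflection exchanging the first basis vector with [- 1 / m] times the
   all-ones vector; the minus sign yields the denominator [m + 1], which never vanishes. *)
pose a : rat := (m%:R * (m%:R + 1))^-1; pose t : rat := m%:R^-1.
pose U := col_mx (- t *: const_mx 1) (1%:M - a *: const_mx 1) : 'M[rat]_(1 + n, n).
have const2 p q : (const_mx 1 : 'M_(p, n)) *m const_mx 1 = n%:R *: const_mx 1 :> 'M[rat]_(p, q).
  apply/matrixP => i j; rewrite !mxE mulr1 (eq_bigr (fun=> 1)) => [|k _].
    by rewrite sumr_const card_ord.
  by rewrite !mxE mulr1.
suff UU : U *m U^T = 1%:M - n.+1%:R^-1 *: const_mx 1 by exists U.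
have trA : (1%:M - a *: const_mx 1 : 'M_n)^T = 1%:M - a *: const_mx 1.
  by apply/matrixP => i j; rewrite !mxE eq_sym.
have trt : (- t *: const_mx 1 : 'M_(1, n))^T = - t *: const_mx 1.
  by apply/matrixP => i j; rewrite !mxE.
rewrite /U tr_col_mx mul_col_row trA trt !mulmxBr !mulmxBl !mulmx1 !mul1mx.
rewrite -!scalemxAl -!scalemxAr !const2 !scalerA n1E.
rewrite (@scalar_mx_block _ 1 n) -(@block_mx_const _ 1 n 1 n) scale_block_mx.
rewrite opp_block_mx add_block_mx.
congr block_mx; apply/matrixP => i j; rewrite !mxE ?ord1 ?mulr1n nE; rewrite /a /t.
- by field.
- by field; rewrite m0.
- by field; rewrite m0.
- by field; rewrite m0.
Qed.

(** The rows of [C] are the centers: they lie in the hyperplane of unit normal [h] at height [m], at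
    mutual distance 2. *)
Lemma simplex_centers n : (0 < n)%N ->
  (exists k : nat,
     (0 < k)%N /\ (n = (2 * k ^ 2)%N \/ n = ((2 * k - 1) ^ 2)%N)) ->
  exists (C : 'M[rat]_n) (h : 'rV[rat]_n) (m : rat),
    [/\ (h *m h^T) 0 0 = 1, forall i, (C *m h^T) i 0 = m
      & forall i j, i != j ->
          (C *m C^T) i i + (C *m C^T) j j - 2 * (C *m C^T) i j = 4].
Proof.
move=> n0 [k [k0 nk]].
have k_neq0 : k%:R != 0 :> rat by rewrite pnatr_eq0 -lt0n.
case: nk => nk.
  have [|B BB] := @orthogonal_double n; first by rewrite nk mul2n odd_double.
  (* The rows of [B] are orthogonal of squared length 2, so their sum has squared length
     [2 * n = (2 * k) ^ 2]. *)
  pose h : 'rV[rat]_n := (2 * k%:R)^-1 *: (const_mx 1 *m B).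
  exists B, h, k%:R^-1; split.
  - rewrite /h linearZ /= trmx_mul -scalemxAl -scalemxAr mulmxA.
    rewrite -[const_mx 1 *m B *m _]mulmxA BB mul_mx_scalar -scalemxAl !scalerA !mxE.
    rewrite (eq_bigr (fun=> 1)) => [|i _]; last by rewrite !mxE mulr1.
    by rewrite sumr_const card_ord nk natrM natrX; field.
  - move=> i; rewrite /h linearZ /= trmx_mul -scalemxAr mulmxA BB mul_scalar_mx.
    by rewrite !mxE; field.
  - by move=> i j /negPf ij; rewrite BB !mxE !eqxx ij mulr1n mulr0n; ring.
case: n n0 nk => // n _ nk.
(* Here [n] is the dimension minus one, hence even. The rows of [U] are at squared distance 2, which
   [B] doubles to 4. *)
have [|B BB] := @orthogonal_double n.
  have -> : n = ((2 * k - 1) ^ 2).-1 by rewrite -nk.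
  rewrite -subn1 oddB ?oddX /=; lia.
have [U UU] := simplex_columns nk.
pose C : 'M[rat]_(n.+1, 1 + n) := row_mx 0 (U *m B).
pose h : 'rV[rat]_(1 + n) := row_mx 1%:M 0.
exists C, h, 0.
have hh : h *m h^T = 1%:M.
  by rewrite /h tr_row_mx mul_row_col trmx1 mulmx1 mul0mx addr0.
have Ch : C *m h^T = 0.
  by rewrite /C /h tr_row_mx mul_row_col trmx0 mul0mx mulmx0 addr0.
have CC : C *m C^T = 2 *: (1%:M - n.+1%:R^-1 *: const_mx 1).
  rewrite /C tr_row_mx mul_row_col mul0mx add0r trmx_mul mulmxA.
  by rewrite -(mulmxA U) BB mul_mx_scalar -scalemxAl UU.
split.
- by have /matrixP /(_ 0 0) := hh; rewrite [in RHS]mxE.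
- by move=> i; have /matrixP /(_ i 0) := Ch; rewrite [in RHS]mxE.
- move=> i j /negPf ij; change ((C *m C^T) i i + (C *m C^T) j j - 2 * (C *m C^T) i j = 4).
  by rewrite CC !mxE !eqxx ij; move: (_^-1) => a; rewrite mulr1n mulr0n; ring.
Qed.

(** The matrix has finitely many entries, so the primes dividing the product of their denominators
    suffice. *)
Lemma exists_primes_integral (R : realType) n (D : 'I_n.+2 -> osphere R n) :
  oriented_descartes D ->
  (forall i j, exists q : rat, curvature_center_mx D i j = ratr q) ->
  exists S : seq nat, (forall p, p \in S -> prime p) /\ super_S_integral S D.
Proof.
move=> oD ratD.
have ratD' (ij : 'I_n.+2 * 'I_(1 + (1 + n))) :
    exists q : rat, curvature_center_mx D ij.1 ij.2 = ratr q by [].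
have [q qE] := choice ratD'.
pose N := (\prod_ij `|denq (q ij)|)%N.
exists (primes N); split; first by move=> p; rewrite mem_primes => /and3P[].
split=> // i j; exists (q (i, j)); first exact: (qE (i, j)).
move=> p p_pr p_dvd; rewrite mem_primes p_pr /=; apply/andP; split.
  by apply: prodn_gt0 => ij; rewrite absz_gt0 denq_neq0.
by rewrite /N (bigD1 (i, j)) //= dvdn_mulr.
Qed.

(** * The Gram determinant and the packing of a slab *)

Section Packing.
Context {R : realType} {n : nat}.

(** Coordinates that diagonalize the Lorentz form, with signs [-1, 1, ..., 1]. *)
Definition lorentz_row (S : osphere R n) : 'rV[R]_(1 + (1 + n)) :=
  row_mx ((cobend S + signed_curvature S) / 2)%:M
    (row_mx ((cobend S - signed_curvature S) / 2)%:M (bend_center S)).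

Definition lorentz_mx (D : 'I_n.+2 -> osphere R n) : 'M[R]_(1 + (1 + n)) :=
  \matrix_(i < n.+2) lorentz_row (D i).

Lemma lorentz_mxP (D : 'I_n.+2 -> osphere R n) :
  lorentz_mx D *m diag_mx (row_mx (- 1)%:M (const_mx 1)) *m (lorentz_mx D)^T =
  \matrix_(i, j) lorentz (D i) (D j).
Proof.
have rowE i k : lorentz_mx D i k = lorentz_row (D i) 0 k by rewrite mxE.
set d := row_mx _ _; apply/matrixP => i j.
rewrite mul_mx_diag [LHS]mxE [RHS]mxE.
rewrite (eq_bigr (fun k =>
  lorentz_row (D i) 0 k * d 0 k * lorentz_row (D j) 0 k)) => [|k _]; last first.
  by rewrite [(_^T) _ _]mxE [(\matrix_(_, _) _) _ _]mxE !rowE.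
rewrite big_split_ord big_ord1 big_split_ord big_ord1 /=.
rewrite (eq_bigr (fun l => bend_center (D i) 0 l * bend_center (D j) 0 l)).
  rewrite -/(dotv _ _) !row_mxEr !row_mxEl [const_mx _ _ _]mxE.
  by rewrite ![_%:M _ _]mxE !eqxx !mulr1n /lorentz; field.
by move=> l _; rewrite !row_mxEr [const_mx _ _ _]mxE mulr1.
Qed.

(** The Gram matrix is [2I - J] of size [n + 2], and the diagonal form contributes the determinant
    [-1]. *)
Lemma det_lorentz_mx (D : 'I_n.+2 -> osphere R n) : oriented_descartes D ->
  \det (lorentz_mx D) ^+ 2 = (n * 2 ^ n.+1)%:R.
Proof.
move=> oD; have := congr1 determinant (lorentz_mxP D).
have -> : \matrix_(i, j) lorentz (D i) (D j) = 2%:M - const_mx 1.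
  apply/matrixP => i j; rewrite !mxE.
  case: eqVneq => [->|ij]; first by rewrite lorentz_self mulr1n; ring.
  by rewrite lorentz_descartes // mulr0n; ring.
rewrite det_scalar_sub_const ?pnatr_eq0 // !det_mulmx det_tr det_diag.
rewrite big_split_ord big_ord1 row_mxEl mxE eqxx mulr1n big1 => [|i _]; last first.
  by rewrite row_mxEr mxE.
rewrite /= mulr1 natrM natrX mulrN1 mulNr -expr2 => /eqP.
by rewrite eqr_oppLR => /eqP ->; rewrite -addn2 natrD; ring.
Qed.

Lemma super_S_integral_rational_square S (D : 'I_n.+2 -> osphere R n) :
  super_S_integral S D -> exists q : rat, q ^+ 2 = (n * 2 ^ n.+1)%:R.
Proof.
move=> [oD intD].
have ratW i j : exists q : rat, curvature_center (D i) 0 j = ratr q.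
  by have [q + _] := intD i j; rewrite mxE; exists q.
have ratL (ij : 'I_(1 + (1 + n)) * 'I_(1 + (1 + n))) :
    exists q : rat, lorentz_mx D ij.1 ij.2 = ratr q.
  case: ij => i j /=; rewrite /lorentz_mx mxE /lorentz_row.
  have [c] := ratW i (lshift _ 0).
  have [b] := ratW i (rshift _ (lshift _ 0)).
  rewrite curvature_centerE row_mxEr !row_mxEl !mxE !mulr1n => bE cE.
  rewrite bE cE; case: (split_ordP j) => l _.
    by exists ((c + b) / 2); rewrite (ord1 l) mxE mulr1n fmorph_div rmorphD rmorph_nat.
  case: (split_ordP l) => o ->.
    by exists ((c - b) / 2); rewrite row_mxEl ord1 mxE mulr1n fmorph_div rmorphB rmorph_nat.
  have [v] := ratW i (rshift _ (rshift _ o)).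
  by rewrite curvature_centerE !row_mxEr => vE; exists v.
have [q qE] := choice ratL.
have LE : lorentz_mx D = map_mx ratr (\matrix_(i, j) q (i, j)).
  by apply/matrixP => i j; rewrite [RHS]mxE mxE; apply: (qE (i, j)).
exists (\det (\matrix_(i, j) q (i, j))); apply: (fmorph_inj (@ratr R)).
by rewrite rmorphXn /= -det_map_mx -LE det_lorentz_mx // rmorph_nat.
Qed.

Lemma dotv_ratr (u v : 'rV[rat]_n) :
  dotv (map_mx ratr u) (map_mx ratr v) = ratr ((u *m v^T) 0 0) :> R.
Proof.
by rewrite mxE rmorph_sum; apply: eq_bigr => i _; rewrite !mxE rmorphM.
Qed.

Variables (c : 'I_n -> 'rV[R]_n) (h : 'rV[R]_n) (m : R) (h1 : sqnorm h = 1).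

(* Unit spheres centered in the hyperplane [y.h = m], between the two parallel
   hyperplanes at distance 1 from it. *)
Definition slab_packing (i : 'I_n.+2) : osphere R n :=
  match @split 2 n i with
  | inl e => if e == 0 then OHyperplane (m + 1) h1
             else OHyperplane (1 - m) (sqnormN h1)
  | inr j => OSphere (c j) ltr01 true
  end.

Lemma oriented_descartes_slab_packing :
  (forall i, dotv (c i) h = m) ->
  (forall i j, i != j -> sqnorm (c i - c j) = 4) ->
  oriented_descartes slab_packing.
Proof.
move=> ch cc; rewrite /slab_packing.
have ne (i j : 'I_n.+2) : i != j -> @split 2 n i != @split 2 n j.
  by apply: contra => /eqP /(can_inj (@splitK 2 n)) ->.
have ord2 (e f : 'I_2) : e != f -> (f == 0) = (e != 0).
  by case: e f => [[|[|?]] ?] [[|[|?]] ?].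
have hc i : dotv h (c i) = m by rewrite dotvC.
apply: oriented_descartes_lorentz => i j /ne.
  case: (@split 2 n i) (@split 2 n j) => [e|k] [f|l]; rewrite /lorentz => ef.
  - rewrite (ord2 e f) //; case: (e == 0);
      by rewrite /= !dotvE -/(sqnorm h) h1; field.
  - by case: (e == 0); rewrite /= invr1 scale1r ?dotvNl hc; field.
  - by case: (f == 0); rewrite /= invr1 scale1r ?dotvNr ch; field.
  - have := cc k l ef; rewrite sqnormD /= invr1 !scale1r /sqnorm !dotvE; lra.
case: (@split 2 n i) (@split 2 n j) => [e|k] [f|l] ef.
(* The two cobends add up to [2 * (m + 1) + 2 * (1 - m) = 4]. *)
- right; rewrite (ord2 e f) //; case: (e == 0); split => //=; lra.
- by left; case: (e == 0); rewrite /= invr1; lra.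
- by left; case: (f == 0); rewrite /= invr1; lra.
- by left; rewrite /= invr1; lra.
Qed.

End Packing.

Lemma rational_slab_packing (R : realType) n (C : 'M[rat]_n) (h : 'rV[rat]_n)
    (m : rat) :
  (h *m h^T) 0 0 = 1 -> (forall i, (C *m h^T) i 0 = m) ->
  (forall i j, i != j ->
     (C *m C^T) i i + (C *m C^T) j j - 2 * (C *m C^T) i j = 4) ->
  exists D : 'I_n.+2 -> osphere R n, oriented_descartes D /\
    forall i j, exists q : rat, curvature_center_mx D i j = ratr q.
Proof.
move=> hh Ch CC.
pose c i : 'rV[R]_n := map_mx ratr (row i C).
have h1 : sqnorm (map_mx ratr h : 'rV[R]_n) = 1.
  by rewrite /sqnorm dotv_ratr hh rmorph1.
have cc i j : dotv (c i) (c j) = ratr ((C *m C^T) i j).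
  rewrite dotv_ratr; congr ratr; rewrite !mxE.
  by apply: eq_bigr => k _; rewrite !mxE.
have rat_row (x y : R) (w : 'rV[R]_n) (a b : rat) (v : 'rV[rat]_n)
    (j : 'I_(1 + (1 + n))) : x = ratr a -> y = ratr b -> w = map_mx ratr v ->
    exists q : rat, row_mx x%:M (row_mx y%:M w) 0 j = ratr q.
  move=> -> -> ->; exists (row_mx a%:M (row_mx b%:M v) 0 j).
  by rewrite -!map_scalar_mx -!map_row_mx mxE.
exists (slab_packing c (ratr m) h1); split.
  apply: oriented_descartes_slab_packing => [i|i j ij].
    rewrite dotv_ratr -(Ch i); congr ratr; rewrite !mxE.
    by apply: eq_bigr => k _; rewrite !mxE.
  rewrite sqnormD /sqnorm !dotvE !cc; have /(congr1 (@ratr R)) := CC i j ij.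
  by rewrite rmorphB rmorphD rmorphM !rmorph_nat => <-; ring.
move=> i j; rewrite mxE curvature_centerE /slab_packing.
case: (@split 2 n i) => [e|k].
  case: (e == 0) => /=.
    apply: (rat_row _ _ _ (2 * (m + 1)) 0 h); rewrite ?rmorph0 //.
    by rewrite rmorphM rmorph_nat rmorphD rmorph1.
  apply: (rat_row _ _ _ (2 * (1 - m)) 0 (- h)); rewrite ?rmorph0 ?map_mxN //.
  by rewrite rmorphM rmorph_nat rmorphB rmorph1.
apply: (rat_row _ _ _ ((C *m C^T) k k - 1) 1 (row k C)) => /=.
- by rewrite !invr1 mul1r /sqnorm cc rmorphB rmorph1.
- by rewrite invr1 rmorph1.
- by rewrite invr1 scale1r.
Qed.

Theorem theorem6p3 (R : realType) (n : nat) (n_ge2 : (2 <= n)%N) :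
  (exists S : seq nat,
     (forall p, p \in S -> prime p) /\
     exists D : 'I_n.+2 -> osphere R n, super_S_integral S D)
  <->
  (exists k : nat,
     (0 < k)%N /\ (n = (2 * k ^ 2)%N \/ n = ((2 * k - 1) ^ 2)%N)).
Proof.
have n_gt0 : (0 < n)%N by exact: leq_trans n_ge2.
split=> [[S [_ [D intD]]]|nk].
  apply: (rational_square_cases n_gt0).
  exact: super_S_integral_rational_square intD.
have [C [h [m [hh Ch CC]]]] := simplex_centers n_gt0 nk.
have [D [oD ratD]] := rational_slab_packing R hh Ch CC.
have [S [prS intD]] := exists_primes_integral oD ratD.
by exists S; split=> //; exists D.
Qed.
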